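(* Let $G$ be a finitely generated group and $N$ a normal subgroup of $G$. If the quotient group $G/N$ is in $\mathcal{FB}_{gen}$, or in $\mathcal{FB}_{st}$, or in $\mathcal{FB}_{exp}$, then the whole group $G$ is in the same class; that is, for each $\ast\in\{gen,st,exp\}$, $G/N\in\mathcal{FB}_{\ast}$ implies $G\in\mathcal{FB}_{\ast}$.
   Context: For a group $G$ with a finite generating set $X$, $F(X)$ denotes the free group with basis $X$, and words in $F(X)$ are evaluated in $G$. Asymptotic density. Fix $k\ge 1$. The size $s(w_1,\dots,w_k)$ of a tuple in $F(X)^k$ is either $|w_1|+\dots+|w_k|$ or $\max_i|w_i|$, where $|\cdot|$ is word length (either choice may be used, fixed throughout). Let $B_n=\{(w_1,\dots,w_k)\in F(X)^k : s(w_1,\dots,w_k)\le n\}$, and for $M\subseteq F(X)^k$ let $\rho_n(M)=|B_n\cap M|/|B_n|$. The set $M$ is generic if $\rho_n(M)\to 1$ as $n\to\infty$; strongly generic if moreover the convergence rate is super-polynomial, i.e. $|1-\rho_n(M)|=o(n^{-r})$ for every $r\in\mathbb N$; exponentially generic if $\rho_n(M)\to 1$ with exponential convergence rate, i.e. $1-\rho_n(M)\le C\delta^n$ for some $C>0$, $\delta\in(0,1)$ and all $n$. Free basis property. A tuple $(u_1,\dots,u_k)\in F(X)^k$ has the free basis property $\mathcal{FB}$ in $G$ if it freely generates a free subgroup in $G$ (i.e. the elements of $G$ represented by $u_1,\dots,u_k$ form a free basis of the subgroup they generate). $\mathcal{FB}_{gen}$ (resp. $\mathcal{FB}_{st}$,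 $\mathcal{FB}_{exp}$) is the class of finitely generated groups $G$ such that for every $k\ge1$ and every finite generating set $X$ of $G$ the set of tuples in $F(X)^k$ having the free basis property in $G$ is generic (resp. strongly generic, exponentially generic) in $F(X)^k$. *)

(* Defs.v *)
From HB Require Import structures.
From mathcomp Require Import all_boot all_order all_algebra finmap.
From mathcomp Require Import generic_quotient.
From mathcomp Require Import all_classical all_reals all_analysis.
Set Implicit Arguments.
Unset Strict Implicit.
Unset Printing Implicit Defensive.
Import Order.TTheory GRing.Theory Num.Theory.
Import numFieldNormedType.Exports.
Local Open Scope classical_set_scope.
Local Open Scope group_scope.

Section FreeGroup.
Variable X : choiceType.

(* (x, false) is the letter x and (x, true) is the letter x^-1; an element of
   the free group on X is represented by its unique reduced word. *)
Definition letter := (X * bool)%type.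
Definition letter_inv (a : letter) : letter := (a.1, ~~ a.2).

Definition reduced : pred (seq letter) :=
  sorted (fun a b => b != letter_inv a).

Record freegroup := FreeGroup { fgword : seq letter; _ : reduced fgword }.

HB.instance Definition _ := [isSub for fgword].
HB.instance Definition _ := [Choice of freegroup by <:].

Definition wlength (w : freegroup) : nat := size (fgword w).

Definition letter_cons (a : letter) (w : seq letter) :=
  if w is b :: w' then if b == letter_inv a then w' else a :: w else [:: a].
Definition word_mul (u v : seq letter) := foldr letter_cons v u.
Definition word_inv (u : seq letter) := rev (map letter_inv u).

Lemma letter_invK : involutive letter_inv.
Proof. by case=> x b; rewrite /letter_inv /= negbK. Qed.

Lemma reduced_cons a w : reduced w -> reduced (letter_cons a w).
Proof.
by case: w => //= b w; case: eqP => [_ /path_sorted //|/eqP nab] /= ->; rewrite nab.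
Qed.

Lemma reduced_mul u v : reduced v -> reduced (word_mul u v).
Proof. by move=> rv; elim: u => //= a u; apply: reduced_cons. Qed.

Lemma letter_consK a w :
  reduced w -> letter_cons (letter_inv a) (letter_cons a w) = w.
Proof.
case: w => [|b w] /=; first by rewrite letter_invK eqxx.
case: eqP => [->|_ _] /=; last by rewrite letter_invK eqxx.
by case: w => //= c w /andP[/negPf-> _].
Qed.

Lemma word_mulA u v w : reduced w ->
  word_mul u (word_mul v w) = word_mul (word_mul u v) w.
Proof.
move=> rw; elim: u => //= a u ->.
move: (word_mul u v) => [|b t] //=; case: eqP => //= ->.
by rewrite -{1}[a]letter_invK letter_consK // reduced_mul.
Qed.

Lemma word_mul1 w : reduced w -> word_mul w [::] = w.
Proof.
elim: w => //= a w IHw paw; rewrite IHw; last exact: path_sorted paw.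
by case: w paw {IHw} => //= b w /andP[/negPf-> _].
Qed.

Lemma word_mulV u v : reduced v -> word_mul (word_inv u) (word_mul u v) = v.
Proof.
move=> rv; elim: u => //= a u IHu.
rewrite /word_inv /= rev_cons /word_mul foldr_rcons letter_consK //.
exact: reduced_mul.
Qed.

Lemma word_invK : involutive word_inv.
Proof. by move=> u; rewrite /word_inv map_rev revK mapK //; apply: letter_invK. Qed.

Lemma reduced_inv u : reduced u -> reduced (word_inv u).
Proof.
rewrite /reduced /word_inv rev_sorted sorted_map; apply: sub_sorted => a b /=.
by apply: contra => /eqP ->; rewrite !letter_invK.
Qed.

Lemma fgword_reduced (u : freegroup) : reduced (fgword u).
Proof. by case: u. Qed.

Definition fg_one := @FreeGroup [::] isT.
Definition fg_mul u v := FreeGroup (reduced_mul (fgword u) (fgword_reduced v)).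
Definition fg_inv u := FreeGroup (reduced_inv (fgword_reduced u)).

Lemma fg_mulA : associative fg_mul.
Proof. by move=> u v w; apply/val_inj/word_mulA/fgword_reduced. Qed.
Lemma fg_mul1g : left_id fg_one fg_mul.
Proof. by move=> u; apply: val_inj. Qed.
Lemma fg_mulg1 : right_id fg_one fg_mul.
Proof. by move=> u; apply/val_inj/word_mul1/fgword_reduced. Qed.
Lemma fg_mulVg : left_inverse fg_one fg_inv fg_mul.
Proof.
move=> u; apply: val_inj; rewrite /= -[X in word_mul _ X]word_mul1 ?fgword_reduced//.
exact: word_mulV.
Qed.
Lemma fg_mulgV : right_inverse fg_one fg_inv fg_mul.
Proof.
move=> u; rewrite -[u in fg_mul u](_ : fg_inv (fg_inv u) = u) ?fg_mulVg //.
by apply/val_inj/word_invK.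
Qed.

HB.instance Definition _ :=
  isGroup.Build freegroup fg_mulA fg_mul1g fg_mulg1 fg_mulVg fg_mulgV.

Definition fg_gen (x : X) : freegroup := @FreeGroup [:: (x, false)] isT.

(* fg_eval_gen, fg_evalM and fg_eval_unique together are the universal property
   of the free group with basis X. *)
Section Eval.
Variables (G : groupType) (g : X -> G).

Definition letter_eval (a : letter) : G := if a.2 then (g a.1)^-1 else g a.1.
Definition fg_eval (w : freegroup) : G := \prod_(a <- fgword w) letter_eval a.

Lemma letter_evalV a : letter_eval (letter_inv a) = (letter_eval a)^-1.
Proof. by case: a => x []; rewrite /letter_eval //= invgK. Qed.

Lemma fg_eval_gen x : fg_eval (fg_gen x) = g x.
Proof. by rewrite /fg_eval big_seq1. Qed.

Lemma fg_evalM : {morph fg_eval : u v / u * v}.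
Proof.
move=> u v; rewrite /fg_eval [fgword (u * v)]/(word_mul (fgword u) (fgword v)).
elim: (fgword u) => [|a s IHs] /=; first by rewrite big_nil mul1g.
rewrite big_cons -mulgA -IHs.
case: (foldr _ _ s) => [|b t] /=; first by rewrite big_seq1 big_nil mulg1.
case: eqP => [->|_]; last by rewrite big_cons.
by rewrite big_cons letter_evalV mulVKg.
Qed.

Lemma fg_evalF : {morph fg_eval : u v / u / v}.
Proof.
move=> u v; apply: (mulIg (fg_eval v)).
by rewrite -fg_evalM !mulgVK.
Qed.

HB.instance Definition _ := isGroupMorphism.Build freegroup G fg_eval fg_evalF.

Lemma fg_eval_unique (f : {multiplicative freegroup -> G}) :
  (forall x, f (fg_gen x) = g x) -> f =1 fg_eval.
Proof.
move=> fg; have f1 : f 1 = 1 by apply: (mulgI (f 1)); rewrite -gmulfM !mulg1.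
have fa a (ra : reduced [:: a]) : f (FreeGroup ra) = letter_eval a.
  case: a ra => x [] ra; last by rewrite /letter_eval -fg; congr (f _); apply: val_inj.
  rewrite /letter_eval /= -fg; apply: (mulIg (f (fg_gen x))); rewrite mulVg -gmulfM -f1.
  by congr (f _); apply: val_inj; rewrite /= /letter_inv eqxx.
case=> w; elim: w => [|a w IHw] rw.
  by rewrite /fg_eval /= big_nil -f1; congr (f _); apply: val_inj.
have rw' := path_sorted rw; have ra : reduced [:: a] by [].
rewrite (_ : FreeGroup rw = FreeGroup ra * FreeGroup rw'); last first.
  by apply: val_inj => /=; case: w rw {IHw rw'} => //= b w /andP[/negPf-> _].
by rewrite gmulfM IHw fg_evalM fa /fg_eval /= big_seq1.
Qed.
End Eval.

End FreeGroup.

(* As everywhere in the algebraic hierarchy, subsets are boolean predicates; by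
   classical logic these are all the subsets of G. *)
HB.mixin Record isConjClosed (G : groupType) (S : {pred G}) := {
  gpredJr : forall x y : G, x \in S -> x ^ y \in S
}.

#[short(type="normalSubgroup")]
HB.structure Definition NormalSubgroup (G : groupType) :=
  {S of GroupClosed G S & isConjClosed G S}.

Section Quotient.
Variables (G : groupType) (N : normalSubgroup G).

Definition coset_eq (x y : G) : bool := x^-1 * y \in N.

Lemma coset_eq_refl : reflexive coset_eq.
Proof. by move=> x; rewrite /coset_eq mulVg gpred1. Qed.
Lemma coset_eq_sym : symmetric coset_eq.
Proof. by move=> x y; rewrite /coset_eq -gpredV invgM invgK. Qed.
Lemma coset_eq_trans : transitive coset_eq.
Proof.
move=> y x z xy yz; rewrite /coset_eq -(mulVKg y z) mulgA.
exact: gpredM.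
Qed.

Canonical coset_equiv := EquivRel coset_eq coset_eq_refl coset_eq_sym coset_eq_trans.

Definition quotient_group := {eq_quot coset_equiv}%qT.

HB.instance Definition _ := Choice.on quotient_group.
HB.instance Definition _ := EqQuotient.on quotient_group.

Definition quot_one : quotient_group := lift_cst quotient_group 1.
Definition quot_mul := lift_op2 quotient_group (fun x y : G => x * y).
Definition quot_inv := lift_op1 quotient_group (fun x : G => x^-1).

Canonical pi_quot_one := PiConst quot_one.

Lemma pi_quot_mul : {morph \pi_quotient_group%qT : x y / x * y >-> quot_mul x y}.
Proof.
move=> x y; unlock quot_mul; apply/eqP; rewrite eqmodE /= /coset_eq.
set x' := repr _; set y' := repr _.
have xx' : x^-1 * x' \in N.
  by rewrite -[_ \in N]/(coset_equiv x x') -eqmodE reprK.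
have yy' : y^-1 * y' \in N.
  by rewrite -[_ \in N]/(coset_equiv y y') -eqmodE reprK.
rewrite (_ : _ * _ = (x^-1 * x') ^ y * (y^-1 * y')); last first.
  by rewrite conjgE invgM !mulgA mulgK.
by apply: gpredM => //; apply: gpredJr.
Qed.
Canonical pi_quot_mul_morph := PiMorph2 pi_quot_mul.

Lemma pi_quot_inv : {morph \pi_quotient_group%qT : x / x^-1 >-> quot_inv x}.
Proof.
move=> x; unlock quot_inv; apply/eqP; rewrite eqmodE /= /coset_eq.
set x' := repr _.
have xx' : x^-1 * x' \in N.
  by rewrite -[_ \in N]/(coset_equiv x x') -eqmodE reprK.
rewrite invgK -gpredV (_ : _^-1 = (x^-1 * x') ^ x^-1); first exact: gpredJr.
by rewrite conjgE !invgM !invgK mulgA mulVKg.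
Qed.
Canonical pi_quot_inv_morph := PiMorph1 pi_quot_inv.

Lemma quot_mulA : associative quot_mul.
Proof.
by move=> x y z; rewrite -[x]reprK -[y]reprK -[z]reprK !piE mulgA.
Qed.
Lemma quot_mul1g : left_id quot_one quot_mul.
Proof. by move=> x; rewrite -[x]reprK !piE mul1g. Qed.
Lemma quot_mulg1 : right_id quot_one quot_mul.
Proof. by move=> x; rewrite -[x]reprK !piE mulg1. Qed.
Lemma quot_mulVg : left_inverse quot_one quot_inv quot_mul.
Proof. by move=> x; rewrite -[x]reprK !piE mulVg. Qed.
Lemma quot_mulgV : right_inverse quot_one quot_inv quot_mul.
Proof. by move=> x; rewrite -[x]reprK !piE mulgV. Qed.

HB.instance Definition _ := isGroup.Build quotient_group
  quot_mulA quot_mul1g quot_mulg1 quot_mulVg quot_mulgV.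

Definition quot_pi (x : G) : quotient_group := (\pi_quotient_group x)%qT.

Lemma quot_piM : {morph quot_pi : x y / x * y}.
Proof. exact: pi_quot_mul. Qed.

Lemma quot_pi_eq1 x : (quot_pi x == 1) = (x \in N).
Proof.
have -> : (1 : quotient_group) = quot_pi 1.
  by symmetry; apply: (mulgI (quot_pi 1)); rewrite -quot_piM !mulg1.
by rewrite eq_sym eqmodE /= /coset_eq invg1 mul1g.
Qed.

Lemma quot_pi_surj (q : quotient_group) : exists x, quot_pi x = q.
Proof. by exists (repr q); apply: reprK. Qed.

End Quotient.

Inductive tuple_size_kind := SumSize | MaxSize.

Definition tuple_size (s : tuple_size_kind) (X : choiceType) (k : nat)
    (u : k.-tuple (freegroup X)) : nat :=
  match s with
  | SumSize => \sum_(w <- u) wlength w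
  | MaxSize => \max_(w <- u) wlength w
  end.

Definition tuple_ball s (X : choiceType) k (n : nat) :
    set (k.-tuple (freegroup X)) :=
  [set u | (tuple_size s u <= n)%N].

(* The junk value #|` fset_set A| = 0 for infinite A never occurs in rho. *)
Lemma finite_tuple_ball s (X : finType) k n : finite_set (@tuple_ball s X k n).
Proof.
pose dec (b : {bseq n of letter X}) : freegroup X := insubd (fg_one X) (b : seq _).
apply: (@sub_finite_set _ _ [set map_tuple dec c | c in [set: k.-tuple _]]).
  move=> u; rewrite /tuple_ball /= => su.
  have lw w : w \in val u -> (size (fgword w) <= n)%N.
    move=> wu; apply: leq_trans su; case: s.
      by rewrite /= (big_rem w) //= leq_addr.
    by rewrite /= (big_rem w) //= leq_maxl.
  exists (map_tuple (fun w => insub_bseq n (fgword w)) u) => //.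
  apply: val_inj => /=; rewrite -map_comp -[RHS]map_id.
  apply/eq_in_map => w wu; rewrite /dec /= /insub_bseq val_insubd lw //.
  exact: valKd.
exact/finite_image/finite_finset.
Qed.

Section Density.
Variables (R : realType) (s : tuple_size_kind) (X : finType) (k : nat).
Implicit Type M : set (k.-tuple (freegroup X)).
Local Open Scope ring_scope.

Definition rho M (n : nat) : R :=
  #|` fset_set (tuple_ball s n `&` M)|%:R / #|` fset_set (@tuple_ball s X k n)|%:R.

Definition generic M : Prop := rho M n @[n --> \oo] --> (1 : R).

Definition strongly_generic M : Prop :=
  generic M /\
  forall r : nat,
    (fun n => `|1 - rho M n|) =o_\oo (fun n => (n%:R : R) ^- r).

Definition exponentially_generic M : Prop :=
  generic M /\
  exists (C delta : R), [/\ 0 < C, 0 < delta, delta < 1 &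
    forall n : nat, 1 - rho M n <= C * delta ^+ n].

End Density.

(* A finite generating set is a finite alphabet X with an evaluation map into G,
   so that distinct letters may have the same value; with this convention the
   image of a generating set of G generates G/N with the same free group F(X). *)
Definition generates (G : groupType) (X : finType) (g : X -> G) : Prop :=
  forall x : G, exists w : freegroup X, fg_eval g w = x.

Definition finitely_generated (G : groupType) : Prop :=
  exists (X : finType) (g : X -> G), generates g.

(* h_1, ..., h_k form a free basis of the subgroup they generate: the canonical
   morphism from the free group of rank k onto that subgroup is injective. *)
Definition freely_generates (G : groupType) (k : nat) (h : 'I_k -> G) : Prop :=
  injective (fg_eval h).

Definition free_basis_tuples (G : groupType) (X : finType) (g : X -> G) k :
    set (k.-tuple (freegroup X)) :=
  [set u | freely_generates (fun i => fg_eval g (tnth u i))].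

Definition FB_class
    (P : forall (X : finType) (k : nat), set (k.-tuple (freegroup X)) -> Prop)
    (G : groupType) : Prop :=
  finitely_generated G /\
  forall (k : nat) (X : finType) (g : X -> G),
    (1 <= k)%N -> generates g -> P X k (@free_basis_tuples G X g k).

Definition FB_gen (R : realType) (s : tuple_size_kind) :=
  FB_class (@generic R s).
Definition FB_st (R : realType) (s : tuple_size_kind) :=
  FB_class (@strongly_generic R s).
Definition FB_exp (R : realType) (s : tuple_size_kind) :=
  FB_class (@exponentially_generic R s).

(* Main.v *)
(* For a generating family g of G, the images of g generate G/N, and a tuple that
   freely generates a free subgroup of G/N already does so in G, because any
   relation in G projects to a relation in G/N.  Hence the free basis tuples for G
   contain those for G/N over the same free group, and each of the three notions
   of genericity is inherited by supersets. *)
Require Import Defs.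
From mathcomp Require Import all_boot all_order all_algebra finmap.
From mathcomp Require Import all_classical all_reals all_analysis.
Set Implicit Arguments.
Unset Strict Implicit.
Unset Printing Implicit Defensive.
Import Order.TTheory GRing.Theory Num.Theory.
Import numFieldNormedType.Exports.
Local Open Scope classical_set_scope.

Section EvalMorphism.
Local Open Scope group_scope.
Variables (G H : groupType) (f : G -> H).
Hypothesis fM : {morph f : x y / x * y}.

(** Evaluation is a product over letters, so [f] passes inside it; as [fM] only covers products,
    compatibility with [1] and inverses is first obtained by cancellation. *)
Lemma morph_fg_eval (X : choiceType) (g : X -> G) (w : freegroup X) :
  f (fg_eval g w) = fg_eval (f \o g) w.
Proof.
have f1 : f 1 = 1 by apply: (mulgI (f 1)); rewrite -fM !mulg1.
have fV x : f x^-1 = (f x)^-1.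
  by apply: (mulIg (f x)); rewrite -fM !mulVg.
rewrite /fg_eval (big_morph f fM f1); apply: eq_bigr => -[x b] _.
by case: b; rewrite /letter_eval /= ?fV.
Qed.

Lemma generates_morph (X : finType) (g : X -> G) :
  (forall y, exists x, f x = y) -> generates g -> generates (f \o g).
Proof.
move=> fsurj gG y; have [x <-] := fsurj y; have [w <-] := gG x.
by exists w; rewrite morph_fg_eval.
Qed.

(** Applying [f] to an equality of two evaluations in [G] gives one in [H], where injectivity is
    assumed. *)
Lemma free_basis_tuples_morph (X : finType) (g : X -> G) k :
  @free_basis_tuples H X (f \o g) k `<=` @free_basis_tuples G X g k.
Proof.
move=> u; rewrite /free_basis_tuples /freely_generates /= => injH w1 w2 w12.
have E : (fun i => fg_eval (f \o g) (tnth u i))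
    = f \o (fun i => fg_eval g (tnth u i)).
  by apply/funext => i; rewrite /= morph_fg_eval.
by apply: injH; rewrite E -!morph_fg_eval w12.
Qed.

End EvalMorphism.

Section DensityMonotone.
Local Open Scope ring_scope.
Variables (R : realType) (s : tuple_size_kind) (X : finType) (k : nat).
Implicit Types M : set (k.-tuple (freegroup X)).

Lemma finite_ballI M n : finite_set (tuple_ball s n `&` M).
Proof. exact/finite_setIl/finite_tuple_ball. Qed.

Lemma rho_le1 M n : rho R s M n <= 1.
Proof.
(* A zero denominator would make the ratio 0 by convention; this case split avoids proving that the
   ball is nonempty. *)
have [b0|b0] := posnP #|` fset_set (@tuple_ball s X k n)|.
  by rewrite /rho b0 invr0 mulr0 ler01.
rewrite /rho ler_pdivrMr ?ltr0n// mul1r ler_nat.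
apply/fsubset_leq_card; rewrite -fset_set_sub; last 2 first.
- exact: finite_ballI.
- exact: finite_tuple_ball.
exact: subIsetl.
Qed.

Lemma le_rho M1 M2 n : M1 `<=` M2 -> rho R s M1 n <= rho R s M2 n.
Proof.
move=> M12; rewrite /rho ler_wpM2r ?invr_ge0 ?ler0n// ler_nat.
apply/fsubset_leq_card; rewrite -fset_set_sub; try exact: finite_ballI.
exact: setIS.
Qed.

(** Squeeze [rho] of [M2] between [rho] of [M1] and the constant 1. *)
Lemma sub_generic M1 M2 : M1 `<=` M2 -> generic R s M1 -> generic R s M2.
Proof.
move=> M12 g1; apply: (@squeeze_cvgr _ _ _ _ (rho R s M1) (fun=> 1)) => //.
- by near=> n; rewrite le_rho// rho_le1.
- exact: cvg_cst.
Unshelve. all: by end_near. Qed.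

Lemma sub_strongly_generic M1 M2 :
  M1 `<=` M2 -> strongly_generic R s M1 -> strongly_generic R s M2.
Proof.
move=> M12 [g1 o1]; split; first exact: sub_generic g1.
move=> r; apply/eqoP => e e0; move/eqoP: (o1 r) => /(_ e e0).
apply: filterS => n /=; apply: le_trans.
(* The little-o bound puts a second norm around the absolute value. Both norms disappear because
   [rho] is at most 1, leaving monotonicity. *)
by rewrite !normr_id !ger0_norm ?subr_ge0 ?rho_le1// lerB// le_rho.
Qed.

Lemma sub_exponentially_generic M1 M2 :
  M1 `<=` M2 -> exponentially_generic R s M1 -> exponentially_generic R s M2.
Proof.
move=> M12 [g1 [C [d [C0 d0 d1 le1]]]]; split; first exact: sub_generic g1.
exists C, d; split=> // n; apply: le_trans (le1 n).
by rewrite lerB// le_rho.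
Qed.

End DensityMonotone.

(** Abstracting over a monotone [P] treats the three classes at once. Finite generation of [G] is
    assumed because it is part of [FB_class] and does not follow from that of the quotient. *)
Lemma FB_class_quotient
    (P : forall (X : finType) (k : nat), set (k.-tuple (freegroup X)) -> Prop)
    (G : groupType) (N : normalSubgroup G) :
  (forall (X : finType) k (M1 M2 : set (k.-tuple (freegroup X))),
    M1 `<=` M2 -> P X k M1 -> P X k M2) ->
  finitely_generated G -> FB_class P (quotient_group N) -> FB_class P G.
Proof.
move=> Psub fgG [_ FBq]; split=> // k X g k0 gG.
apply: Psub (FBq k X (quot_pi N \o g) k0 _).
  exact/free_basis_tuples_morph/quot_piM.
by apply: generates_morph gG; [exact: quot_piM | exact: quot_pi_surj].
Qed.

Theorem theorem2p6 (R : realType) (s : tuple_size_kind)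
    (G : groupType) (N : normalSubgroup G) :
  finitely_generated G ->
  [/\ FB_gen R s (quotient_group N) -> FB_gen R s G,
      FB_st R s (quotient_group N) -> FB_st R s G &
      FB_exp R s (quotient_group N) -> FB_exp R s G].
Proof.
move=> fgG; split; apply: FB_class_quotient => //.
- exact: sub_generic.
- exact: sub_strongly_generic.
- exact: sub_exponentially_generic.
Qed.
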